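(* Let $u_{\mathrm{NN}}:\mathbb R^p\to\mathcal H$ have an $L$-Lipschitz Jacobian and a $\lambda_{\tilde w}$-non-degenerate Jacobian at $\tilde w\in\mathbb R^p$, and let $r_{\tilde w}>0$, $\mathcal M_{\tilde w}$ and $\mathcal K_{\tilde w}$ be as defined in the context. Then $\mathcal M_{\tilde w}$ is a $p$-dimensional boundaryless smooth embedded submanifold of $\mathcal H$, and $\mathcal K_{\tilde w}$ is a compact subset of $\mathcal M_{\tilde w}$.
   Context: $\mathcal H$ is a real Hilbert space with norm $\|\cdot\|_{\mathcal H}$; $p\ge 1$; $u_{\mathrm{NN}}:\mathbb R^p\to\mathcal H$ is a smooth map (the network realization map), Lipschitz with finite constant $\mathrm{Lip}_{u_{\mathrm{NN}}}>0$. $\mathrm D u_{\mathrm{NN}}(w):\mathbb R^p\to\mathcal H$ is its Fréchet derivative and $\mathrm D u_{\mathrm{NN}}(w)^*$ the adjoint. $u_{\mathrm{NN}}$ has an $L$-Lipschitz Jacobian ($L>0$) if $u_{\mathrm{NN}}\in C^2(\mathbb R^p;\mathcal H)$ and $\|\mathrm D u_{\mathrm{NN}}(w_1)-\mathrm D u_{\mathrm{NN}}(w_2)\|_{\mathrm{op}}\le L\|w_1-w_2\|_2$ for all $w_1,w_2\in\mathbb R^p$. It has a $\lambda$-non-degenerate Jacobian at $w$ ($\lambda>0$) if $\mathrm D u_{\mathrm{NN}}(w)^*\mathrm D u_{\mathrm{NN}}(w)\succeq 4\lambda^2 I_p$. $\mathcal F:\mathcal H\to\mathbb R$ is continuously Fréchet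 differentiable, $m_{\mathcal F}$-strongly convex ($m_{\mathcal F}>0$) with $L_{\mathcal F}$-Lipschitz gradient, and $\tau>0$; these enter only through the radius $$r_{\tilde w}:=\min\Big\{\tfrac{\lambda_{\tilde w}}{L},\ \tfrac{\lambda_{\tilde w}^2}{2L\big(\sqrt{\|\mathrm D u_{\mathrm{NN}}(\tilde w)\|_{\mathrm{op}}^2+\lambda_{\tilde w}^2}+\|\mathrm D u_{\mathrm{NN}}(\tilde w)\|_{\mathrm{op}}\big)},\ \tfrac{\lambda_{\tilde w}^2(1+\tau m_{\mathcal F})}{4L\,\mathrm{Lip}_{u_{\mathrm{NN}}}(1+\tau L_{\mathcal F})}\Big\}.$$ The increment manifold is $\mathcal M_{\tilde w}:=\{u_{\mathrm{NN}}(w)-u_{\mathrm{NN}}(\tilde w):\ \|w-\tilde w\|_2<r_{\tilde w}\}\subset\mathcal H$ and the localization image is $\mathcal K_{\tilde w}:=\{u_{\mathrm{NN}}(w)-u_{\mathrm{NN}}(\tilde w):\ \|w-\tilde w\|_2\le r_{\tilde w}/2\}$. *)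

(* Defs.v *)
From HB Require Import structures.
From mathcomp Require Import all_boot all_order all_algebra.
From mathcomp Require Import all_classical all_reals all_analysis.

Set Implicit Arguments.
Unset Strict Implicit.
Unset Printing Implicit Defensive.

Import Order.TTheory GRing.Theory Num.Theory.
Import numFieldNormedType.Exports.

Local Open Scope classical_set_scope.
Local Open Scope ring_scope.

(* The library norm of 'rV[R]_p is the sup norm: it induces the usual topology
   and the usual differential, but metric quantities on R^p must go through
   [enorm]. *)
Definition edot (R : realType) (p : nat) (v w : 'rV[R]_p) : R :=
  \sum_(i < p) v 0 i * w 0 i.

Definition enorm (R : realType) (p : nat) (v : 'rV[R]_p) : R :=
  Num.sqrt (edot v v).

(* Together with completeness of H, this makes H a real Hilbert space. *)
Definition induces_norm (R : realType) (H : normedModType R)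
    (dot : {dot H for idfun}) : Prop :=
  forall x : H, `|x| ^+ 2 = dot x x.

(* N is the norm on the domain. The supremum is meaningful for bounded
   operators, the only ones it is used for. *)
Definition opnorm (R : realType) (V W : normedModType R) (N : V -> R)
    (A : V -> W) : R :=
  sup [set `|A v| | v in [set v | N v <= 1]].

Definition adjoint (R : realType) (p : nat) (H : normedModType R)
    (dot : {dot H for idfun}) (A : 'rV[R]_p -> H) (h : H) : 'rV[R]_p :=
  \row_i dot (A (delta_mx 0 i)) h.

Lemma adjointP (R : realType) (p : nat) (H : normedModType R)
    (dot : {dot H for idfun}) (A : {linear 'rV[R]_p -> H}) (v : 'rV[R]_p)
    (h : H) :
  dot (A v) h = edot v (adjoint dot A h).
Proof.
rewrite /edot {1}(row_sum_delta v) linear_sum linear_sumlz /=.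
by apply: eq_bigr => i _; rewrite mxE linearZ linearZl_LR.
Qed.

Definition psd (R : realType) (p : nat) (T : 'rV[R]_p -> 'rV[R]_p) : Prop :=
  (forall v w, edot (T v) w = edot v (T w)) /\ (forall v, 0 <= edot (T v) v).

Definition loewner_ge (R : realType) (p : nat)
    (S T : 'rV[R]_p -> 'rV[R]_p) : Prop :=
  psd (fun v => S v - T v).

(* C^k on an open set U of R^p. As R^p is finite-dimensional, the derivative
   x |-> 'd f x is C^k for the operator norm iff all its evaluations
   x |-> 'd f x v are C^k. *)
Fixpoint C_on (R : realType) (p : nat) (W : normedModType R) (k : nat)
    (U : set 'rV[R]_p) (f : 'rV[R]_p -> W) : Prop :=
  match k with
  | 0%N => forall x, U x -> {for x, continuous f}
  | k'.+1 => (forall x, U x -> differentiable f x) /\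
             (forall v, C_on k' U (fun x => 'd f x v))
  end.

Definition smooth_on (R : realType) (p : nat) (W : normedModType R)
    (U : set 'rV[R]_p) (f : 'rV[R]_p -> W) : Prop :=
  forall k, C_on k U f.

Definition lipschitz_jacobian (R : realType) (p : nat) (H : normedModType R)
    (u : 'rV[R]_p -> H) (L : R) : Prop :=
  C_on 2 setT u /\
  forall w1 w2,
    opnorm (@enorm R p) (fun v => 'd u w1 v - 'd u w2 v) <= L * enorm (w1 - w2).

Definition nondegenerate_jacobian (R : realType) (p : nat)
    (H : normedModType R) (dot : {dot H for idfun}) (u : 'rV[R]_p -> H)
    (lambda : R) (w : 'rV[R]_p) : Prop :=
  loewner_ge (fun v => adjoint dot ('d u w) ('d u w v))
             (fun v => (4 * lambda ^+ 2) *: v).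

Definition continuously_differentiable (R : realType) (H : normedModType R)
    (F : H -> R) : Prop :=
  (forall x, differentiable F x) /\
  (forall x, opnorm Num.norm (fun h => 'd F y h - 'd F x h) @[y --> x] --> 0).

(* The Riesz representative of the differential. *)
Definition gradient (R : realType) (H : normedModType R)
    (dot : {dot H for idfun}) (F : H -> R) (x : H) : H :=
  xget 0 [set g | forall h, 'd F x h = dot g h].

Definition strongly_convex (R : realType) (H : normedModType R)
    (F : H -> R) (m : R) : Prop :=
  forall (x y : H) (t : R), 0 <= t <= 1 ->
    F (t *: x + (1 - t) *: y) <=
      t * F x + (1 - t) * F y - m / 2 * t * (1 - t) * `|x - y| ^+ 2.

Definition localization_radius (R : realType) (p : nat) (H : normedModType R)
    (u : 'rV[R]_p -> H) (wt : 'rV[R]_p) (L lambda Lip tau mF LF : R) : R :=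
  let D := opnorm (@enorm R p) ('d u wt) in
  Num.min (lambda / L)
    (Num.min
      (lambda ^+ 2 / (2 * L * (Num.sqrt (D ^+ 2 + lambda ^+ 2) + D)))
      (lambda ^+ 2 * (1 + tau * mF) / (4 * L * Lip * (1 + tau * LF)))).

Definition increment_manifold (R : realType) (p : nat) (H : normedModType R)
    (u : 'rV[R]_p -> H) (wt : 'rV[R]_p) (r : R) : set H :=
  [set u w - u wt | w in [set w | enorm (w - wt) < r]].

Definition localization_image (R : realType) (p : nat) (H : normedModType R)
    (u : 'rV[R]_p -> H) (wt : 'rV[R]_p) (r : R) : set H :=
  [set u w - u wt | w in [set w | enorm (w - wt) <= r / 2]].

(* A chart is given by its inverse [chart_param] : [chart_dom] -> M, together
   with the coordinate map [chart_coord]; both are total functions, constrained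
   only on [chart_dom] and on its image. *)
Record chart (R : realType) (p : nat) (H : normedModType R) := Chart {
  chart_dom : set 'rV[R]_p;
  chart_param : 'rV[R]_p -> H;
  chart_coord : H -> 'rV[R]_p }.

Definition chart_range (R : realType) (p : nat) (H : normedModType R)
    (c : chart p H) : set H :=
  chart_param c @` chart_dom c.

(* A homeomorphism between an open subset of R^p (hence no boundary) and a
   relatively open subset of M. *)
Definition chart_on (R : realType) (p : nat) (H : normedModType R)
    (M : set H) (c : chart p H) : Prop :=
  [/\ open (chart_dom c),
      exists2 V : set H, open V & chart_range c = M `&` V,
      forall x, chart_dom c x -> chart_coord c (chart_param c x) = x,
      {within chart_dom c, continuous (chart_param c)} &
      {within chart_range c, continuous (chart_coord c)}].

Definition smoothly_compatible (R : realType) (p : nat) (H : normedModType R)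
    (c d : chart p H) : Prop :=
  smooth_on (chart_dom c `&` chart_param c @^-1` chart_range d)
    (chart_coord d \o chart_param c).

Definition smooth_atlas (R : realType) (p : nat) (H : normedModType R)
    (M : set H) (A : set (chart p H)) : Prop :=
  [/\ forall c, A c -> chart_on M c,
      forall x, M x -> exists2 c, A c & chart_range c x &
      forall c d, A c -> A d -> smoothly_compatible c d].

(* [chart_param c] is the coordinate expression of the inclusion of M into H.
   The image of its differential is finite-dimensional, hence closed and
   complemented, so that injectivity of the differential is all that an
   immersion requires. *)
Definition immersive_chart (R : realType) (p : nat) (H : normedModType R)
    (c : chart p H) : Prop :=
  smooth_on (chart_dom c) (chart_param c) /\
  forall x, chart_dom c x -> injective ('d (chart_param c) x).

(* M, with the subspace topology, is a second countable topological manifold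
   without boundary of dimension p (it is Hausdorff because H is), carrying a
   smooth structure for which the inclusion into H is a smooth embedding, that
   is, an immersion which is a homeomorphism onto its image; the latter holds
   by the choice of the topology. *)
Definition smooth_embedded_submanifold (R : realType) (p : nat)
    (H : normedModType R) (M : set H) : Prop :=
  @second_countable (set_type M) /\
  exists A : set (chart p H),
    smooth_atlas M A /\ forall c, A c -> immersive_chart c.

(* Main.v *)
(* On the ball of radius r <= lambda / L around wt, the Jacobian differs from
   D u(wt) by at most lambda in operator norm, while the non-degeneracy at wt
   gives |D u(wt) v| >= 2 lambda |v|. Hence every D u(w) in the ball is
   injective and, by the mean value inequality applied to u - D u(wt), the map
   u expands distances at least by lambda. It is therefore a homeomorphism of
   the ball onto its image, with Lipschitz inverse, and its restriction to the
   ball is a single global chart of the increment manifold. Positivity of r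
   requires LF >= 0, which holds because D u(wt) is injective and p >= 1, so
   that H is nontrivial. *)
Require Import Defs.
From HB Require Import structures.
From mathcomp Require Import all_boot all_order all_algebra.
From mathcomp Require Import all_classical all_reals all_analysis.
From mathcomp Require Import ring lra.
Import Order.TTheory GRing.Theory Num.Theory.
Import numFieldNormedType.Exports.
Local Open Scope classical_set_scope.
Local Open Scope ring_scope.

(** * Locality of the differential and stability of smoothness *)

Lemma near_eq_is_diff {R : realType} {V W : normedModType R} (f g : V -> W)
    (x : V) (df : V -> W) :
  {near x, f =1 g} -> is_diff x f df -> is_diff x g df.
Proof.
move=> fg dfx.
(* [g - f] vanishes near [x], so its differential there is zero; [g] is then recovered as
   [f + (g - f)]. *)
have h0 : is_diff x (g - f) 0.
  have e : (g - f) \o shift x = cst ((g - f) x) + (0 : V -> W) +o_ 0 id.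
    apply/eqaddoP => _/posnumP[e].
    have gfx : (g - f) x = 0.
      by rewrite !fctE (nbhs_singleton fg) subrr.
    have := fg; rewrite (near_shift 0) => fg0.
    near=> y.
    rewrite gfx !fctE.
    have -> : f (y + x) = g (y + x).
      have : (f \o shift x) y = (g \o shift x) y.
        by near: y; move: fg0; rewrite /= subr0.
      by [].
    by rewrite subrr addr0 subr0 normr0 mulr_ge0.
  have d0 := @diff_unique _ _ _ _ (\0 : {linear V -> W}) x
    (@cst_continuous _ _ 0) e.
  split; last exact: d0.
  apply/diff_locallyP; rewrite d0; split => //; exact: cst_continuous.
have -> : g = f + (g - f) by rewrite addrC subrK.
rewrite -[df]addr0; exact: is_diffD dfx h0.
Unshelve. all: by end_near. Qed.

Section Smoothness.
Context {R : realType} {p : nat} {W : normedModType R}.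
Implicit Types (U : set 'rV[R]_p) (f g : 'rV[R]_p -> W).

(** Openness of [U] turns equality on [U] into equality near each of its points, so the
    differentials agree on [U] as well and the induction on [k] can proceed. *)
Lemma C_on_eq k U f g :
  open U -> (forall x, U x -> f x = g x) -> C_on k U f -> C_on k U g.
Proof.
elim: k f g => [|k IH] f g Uo fg; have nfg x : U x -> {near x, f =1 g}.
- by move=> Ux; exact: filterS (open_nbhs_nbhs (conj Uo Ux)).
- move=> cf x Ux; rewrite /prop_for /continuous_at -(fg _ Ux).
  exact: cvg_trans (near_eq_cvg (nfg x Ux)) (cf x Ux).
- by move=> Ux; exact: filterS (open_nbhs_nbhs (conj Uo Ux)).
move=> [df Cdf].
have dg x : U x -> is_diff x g ('d f x).
  by move=> Ux; exact: near_eq_is_diff (nfg x Ux) (differentiableP (df x Ux)).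
split=> [x /dg[]//|v].
apply: (IH _ _ Uo _ (Cdf v)) => x /dg[_ e].
exact: (esym (congr1 (@^~ v) e)).
Qed.

Lemma C_on_sub k U U' f : U `<=` U' -> C_on k U' f -> C_on k U f.
Proof.
move=> UU'; elim: k f => [|k IH] f /=; first by move=> cf x /UU'/cf.
by move=> [df Cdf]; split=> [x /UU'/df //|v]; apply: IH.
Qed.

Lemma smooth_on_cst U (a : W) : smooth_on U (cst a).
Proof.
move=> k; elim: k a => [|k IH] a /=; first by move=> x _; exact: cst_continuous.
split=> [x _|v]; first exact: differentiable_cst.
by under eq_fun do rewrite diff_cst; exact: IH.
Qed.

Lemma diff_subc f (a : W) x :
  differentiable f x -> is_diff x (fun y => f y - a) ('d f x).
Proof.
move=> /differentiableP dfx; rewrite -['d f x : _ -> _]subr0.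
exact: is_diffB dfx (is_diff_cst a x).
Qed.

Lemma smooth_on_subc U f (a : W) :
  open U -> smooth_on U f -> smooth_on U (fun x => f x - a).
Proof.
move=> Uo sf; case=> [|k] /=.
  by move=> x Ux; apply: cvgB (sf 0%N x Ux) _; exact: cvg_cst.
have [df Cdf] := sf k.+1; split=> [x Ux|v].
  by have [] := diff_subc f a x (df x Ux).
apply: (C_on_eq _ _ _ _ Uo _ (Cdf v)) => x Ux.
have [_ e] := diff_subc f a x (df x Ux).
exact: (esym (congr1 (@^~ v) e)).
Qed.

End Smoothness.

Lemma smooth_on_id {R : realType} {p : nat} (U : set 'rV[R]_p) : smooth_on U id.
Proof.
case=> [|k] /=; first by move=> x _; exact: cvg_id.
split=> [x _|v]; first exact: ex_diff.
by under eq_fun do rewrite diff_val; exact: smooth_on_cst.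
Qed.

(** * The Euclidean norm and its comparison with the sup norm *)

Section EuclideanNorm.
Context {R : realType} {p : nat}.
Implicit Types v w x y : 'rV[R]_p.

Lemma edot_ge0 v : 0 <= edot v v.
Proof. by apply: sumr_ge0 => i _; rewrite -expr2 sqr_ge0. Qed.

Lemma sqr_enorm v : enorm v ^+ 2 = edot v v.
Proof. by rewrite sqr_sqrtr // edot_ge0. Qed.

Lemma enorm_ge0 v : 0 <= enorm v.
Proof. exact: sqrtr_ge0. Qed.

Lemma enorm0 : enorm (0 : 'rV[R]_p) = 0.
Proof. by rewrite /enorm /edot big1 ?sqrtr0 // => i _; rewrite mxE mul0r. Qed.

Lemma enormZ a v : enorm (a *: v) = `|a| * enorm v.
Proof.
rewrite /enorm -sqrtr_sqr -sqrtrM ?sqr_ge0 // /edot mulr_sumr.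
by congr Num.sqrt; apply: eq_bigr => i _; rewrite mxE; ring.
Qed.

Lemma ler_norm_enorm v : `|v| <= enorm v.
Proof.
rewrite [leLHS]/Num.norm /= mx_normrE; apply: bigmax_le => [|[i j] _ /=].
  exact: enorm_ge0.
rewrite (ord1 i) -sqrtr_sqr ler_wsqrtr // /edot (bigD1 j) //= expr2 lerDl.
by apply: sumr_ge0 => k _; rewrite -expr2 sqr_ge0.
Qed.

Lemma enorm_eq0 v : enorm v = 0 -> v = 0.
Proof.
by move=> v0; apply/eqP; rewrite -normr_le0 -v0 ler_norm_enorm.
Qed.

Lemma enorm_lt_segment r t x y :
  enorm x < r -> enorm y < r -> 0 <= t <= 1 -> enorm (x + t *: (y - x)) < r.
Proof.
move=> xr yr /andP[t0 t1].
have r0 : 0 < r by exact: le_lt_trans (enorm_ge0 x) xr.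
have sq (z : 'rV[R]_p) : (enorm z < r) = (edot z z < r ^+ 2).
  by rewrite -sqr_enorm ltr_pXn2r // nnegrE ?enorm_ge0 ?ltW.
move: xr yr; rewrite !sq => xr yr.
(* Stewart's identity; its last term is nonpositive on the segment, which gives convexity of the
   squared norm. *)
have : edot (x + t *: (y - x)) (x + t *: (y - x)) =
    (1 - t) * edot x x + t * edot y y - t * (1 - t) * edot (y - x) (y - x).
  rewrite /edot !mulr_sumr -sumrN -!big_split /=.
  by apply: eq_bigr => i _; rewrite !mxE; ring.
have := edot_ge0 (y - x); set d := edot (y - x) _; move=> d0 ->.
have : 0 <= t * (1 - t) * d by rewrite !mulr_ge0 // subr_ge0.
(* The strict inequality is drawn from the [y] term, which requires [t > 0]. *)
have [->|tn0] := eqVneq t 0; first lra.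
have tp : 0 < t by rewrite lt_def tn0.
have : t * edot y y < t * r ^+ 2 by rewrite ltr_pM2l.
have : (1 - t) * edot x x <= (1 - t) * r ^+ 2.
  by rewrite ler_wpM2l ?subr_ge0 // ltW.
lra.
Qed.

Lemma continuous_enorm : continuous (@enorm R p).
Proof.
move=> v; apply: continuous_comp; last exact: sqrt_continuous.
rewrite /edot; apply: continuous_big => [|i _ w]; first exact: add_continuous.
by apply: continuousM; exact: coord_continuous.
Qed.

Lemma continuous_enorm_subc (a : 'rV[R]_p) :
  continuous (fun w => enorm (w - a)).
Proof.
move=> v; apply: continuous_comp; last exact: continuous_enorm.
by apply: continuousB; [exact: cvg_id|exact: cst_continuous].
Qed.

Lemma open_enorm_ball (a : 'rV[R]_p) r : open [set w | enorm (w - a) < r].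
Proof.
apply: (@open_comp _ _ (fun w => enorm (w - a)) [set x | x < r]).
  by move=> v _; exact: continuous_enorm_subc.
exact: open_lt.
Qed.

Lemma compact_enorm_ball (a : 'rV[R]_p) r :
  compact [set w | enorm (w - a) <= r].
Proof.
apply: bounded_closed_compact.
  exists (`|a| + r); split; first exact: num_real.
  move=> M /ltW rM w /= wr; apply: le_trans rM.
  rewrite -[w](subrK a) addrC (le_trans (ler_normD _ _)) // lerD2l.
  exact: le_trans (ler_norm_enorm _) wr.
apply: (@closed_comp _ _ (fun w => enorm (w - a)) [set x | x <= r]).
  by move=> v _; exact: continuous_enorm_subc.
exact: closed_le.
Qed.

(** Continuity bounds the set defining [opnorm], so that [sup] is a genuine upper bound; a nonzero
    [v] is then rescaled to unit length. *)
Lemma le_opnorm {W : normedModType R} (A : {linear 'rV[R]_p -> W}) v :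
  continuous A -> `|A v| <= opnorm (@enorm R p) A * enorm v.
Proof.
move=> /linear_lipschitz[k k0 Ak].
have ub w : enorm w <= 1 -> `|A w| <= opnorm (@enorm R p) A.
  move=> w1; apply: ub_le_sup; last by exists w.
  exists k => _ [z z1 <-]; apply: le_trans (Ak z) _.
  by rewrite ler_piMr ?(ltW k0) // (le_trans (ler_norm_enorm z)).
have [v0|v0] := eqVneq (enorm v) 0.
  by rewrite (enorm_eq0 _ v0) linear0 normr0 enorm0 mulr0.
have vp : 0 < enorm v by rewrite lt_def v0 enorm_ge0.
rewrite -ler_pdivrMr // mulrC -[(enorm v)^-1]gtr0_norm ?invr_gt0 //.
rewrite -normrZ -linearZ; apply: ub.
by rewrite enormZ gtr0_norm ?invr_gt0 // mulVf.
Qed.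

End EuclideanNorm.

(** * Cauchy-Schwarz and the mean value inequality *)

Section InnerProduct.
Context {R : realType} {H : normedModType R} (dot : {dot H for idfun}).
Hypothesis dotE : induces_norm dot.

Lemma dotC x y : dot x y = dot y x.
Proof. by rewrite hermC /= expr0 mul1r. Qed.

(** As the norm is given beforehand, Cauchy-Schwarz is read off its triangle inequality by squaring
    and expanding. *)
Lemma dot_le_norm x y : dot x y <= `|x| * `|y|.
Proof.
have : `|x + y| ^+ 2 <= (`|x| + `|y|) ^+ 2.
  by rewrite ler_pXn2r ?nnegrE ?addr_ge0 // ler_normD.
rewrite dotE linearDr !linearDl /= sqrrD !dotE (dotC y x).
lra.
Qed.

Lemma normr_dot_le x y : `|dot x y| <= `|x| * `|y|.
Proof.
rewrite ler_norml dot_le_norm andbT lerNl -linearNl -(normrN x).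
exact: dot_le_norm.
Qed.

Definition dotl h : H -> R := dot^~ h.

Lemma dotl_is_linear h : linear (dotl h : H -> R^o).
Proof. by move=> a x y; rewrite /dotl linearPl. Qed.

HB.instance Definition _ h :=
  GRing.isLinear.Build R H R^o _ (dotl h) (dotl_is_linear h).

Lemma dotl_continuous h : continuous (dotl h).
Proof.
apply: (@bounded_linear_continuous _ _ R^o); apply/linear_boundedP.
near=> r => x; rewrite (le_trans (normr_dot_le _ _)) // mulrC ler_wpM2r //.
Unshelve. all: by end_near. Qed.

(* Pairing with the left-hand vector itself reduces the claim to the scalar mean
   value theorem. *)
Lemma mean_value_le {p : nat} (u : 'rV[R]_p -> H) (x v : 'rV[R]_p) (a : H) C :
  (forall w, differentiable u w) ->
  (forall t, 0 <= t <= 1 -> `|'d u (x + t *: v) v - a| <= C) ->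
  `|u (x + v) - u x - a| <= C.
Proof.
move=> du uC; set h := u (x + v) - u x - a.
(* The correction [t *: a] makes the increment of [g] over [0, 1] equal to the squared norm of
   [h]. *)
pose g t := dotl h (u (x + t *: v) - t *: a).
have dg (t : R) : is_derive t 1 g (dotl h ('d u (x + t *: v) v - a)).
  have dpath : is_diff t (fun s : R => x + s *: v) (fun s => s *: v).
    rewrite -[X in is_diff _ _ X]add0r.
    exact: is_diffD (is_diff_cst x t) (is_diff_scalel t v).
  have dl b : is_diff (b : H) (dotl h : H -> R^o) (dotl h).
    apply: DiffDef; first exact: linear_differentiable (dotl_continuous h).
    exact: diff_lin (dotl_continuous h).
  have dua := is_diffB (is_diff_comp dpath (differentiableP (du (x + t *: v))))
    (is_diff_scalel t a).
  have dgt := is_diff_comp dua (dl _).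
  have dg' : is_diff t g _ := dgt.
  have [gd gE] := dg'.
  apply: DeriveDef; first exact/derivable1_diffP.
  by rewrite deriveE // gE /= !fctE /= !scale1r.
have [|t t01] := @MVT_segment R g _ 0 1 ler01 (fun t _ => dg t).
  apply: continuous_subspaceT => t; apply: differentiable_continuous.
  by apply/derivable1_diffP; have [] := dg t.
rewrite in_itv /= in t01.
rewrite subr0 mulr1 /g scale0r scale1r addr0 scale0r subr0 scale1r => e.
have {}e : `|h| ^+ 2 = dotl h ('d u (x + t *: v) v - a).
  by rewrite -e -linearB dotE /h addrAC.
(* When [h] is zero nothing can be cancelled, and [0 <= C] comes from the hypothesis at [t = 0]. *)
have [->|h0] := eqVneq h 0.
  by rewrite normr0; apply: le_trans (uC 0 _); rewrite ?lexx ?ler01.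
rewrite -(@ler_pM2r _ `|h|) ?normr_gt0 // -expr2 e.
by rewrite (le_trans (dot_le_norm _ _)) // ler_wpM2r // uC.
Qed.
End InnerProduct.

(** * Second countability and the single-chart criterion *)

Lemma second_countable_initial {S T : topologicalType} (e : S -> T) :
  continuous e ->
  (forall x A, nbhs x A -> exists2 B, nbhs (e x) B & e @^-1` B `<=` A) ->
  @second_countable T -> @second_countable S.
Proof.
(* [ce] and [eI] say that [S] has the initial topology of [e], so preimages of a basis form a
   basis. *)
move=> ce eI [B cB [Bo Bb]]; exists (preimage e @` B).
  exact: sub_countable (card_image_le _ _) cB.
split=> [_ [U BU <-]|x A /eI[V xV VA]].
  by apply: open_comp => [y _|]; [exact: ce|exact: Bo].
have [U [BU Ux] UV] := Bb (e x) V xV.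
exists (e @^-1` U); first by split=> //; exists U.
by apply: subset_trans VA => y; exact: UV.
Qed.

(** The basis consists of balls with rational centres and radii [1 / (n + 1)]; for the sup norm a
    nearby rational centre is found coordinatewise. *)
Lemma second_countable_rV (R : realType) p : @second_countable 'rV[R]_p.
Proof.
pose b (qn : 'rV[rat]_p * nat) : set 'rV[R]_p :=
  ball (map_mx ratr qn.1 : 'rV[R]_p) (qn.2.+1%:R^-1).
exists (range b); first exact: sub_countable (card_image_le _ _) (countableP _).
split=> [_ [qn _ <-]|x A].
  by apply: ball_open; rewrite invr_gt0.
move=> /nbhs_ballP[e /= e0 xeA].
have [n ne] : exists n, n.+1%:R^-1 < e / 2.
  have [|n] := @ltr_add_invr R 0 (e / 2); rewrite ?divr_gt0 // add0r.
  by exists n.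
have n0 : 0 < n.+1%:R^-1 :> R by rewrite invr_gt0.
have /choice[q xq] (i : 'I_p) :
    exists q : rat, ball (x 0 i) n.+1%:R^-1 (ratr q).
  have /rat_in_itvoo[q /itvP qx] : x 0 i < x 0 i + n.+1%:R^-1 by rewrite ltrDl.
  exists q; rewrite /ball /= distrC ltr_distl qx andbT.
  by rewrite (@lt_trans _ _ (x 0 i)) ?qx // ltrBlDl ltrDr.
have bx : ball x n.+1%:R^-1 (map_mx ratr (\row_i q i) : 'rV[R]_p).
  by split=> // j i; rewrite !mxE (ord1 j).
exists (b (\row_i q i, n)).
  by split; [exists (\row_i q i, n)|exact: ball_sym].
move=> y yb; apply: xeA; rewrite [e]splitr.
by apply: (ball_triangle (le_ball (ltW ne) bx)); exact: le_ball (ltW ne) _ yb.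
Qed.

(** The lower bound makes [f] injective on [U] with a [1 / c]-Lipschitz inverse, so [f] itself is a
    global chart whose only transition map is the identity of [U]. *)
Lemma smooth_embedded_image {R : realType} {p : nat} {H : normedModType R}
    (U : set 'rV[R]_p) (f : 'rV[R]_p -> H) (c : R) :
  0 < c -> open U -> smooth_on U f ->
  (forall x y, U x -> U y -> c * `|x - y| <= `|f x - f y|) ->
  (forall x, U x -> injective ('d f x)) ->
  smooth_embedded_submanifold p (f @` U).
Proof.
move=> c0 Uo fs fc dfI.
(* The inverse of [f], with default value 0 off the image. *)
pose g h := xget 0 [set w | U w /\ f w = h].
have gU h : (f @` U) h -> U (g h) /\ f (g h) = h.
  by move=> [w Uw wh]; apply: (@xgetPex _ 0 [set w | U w /\ f w = h]); exists w.
have gK x : U x -> g (f x) = x.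
  move=> Ux; have [|Ug fg] := gU (f x); first by exists x.
  apply/eqP; rewrite -subr_eq0 -normr_le0 -(pmulr_rle0 _ c0).
  by rewrite (le_trans (fc _ _ Ug Ux)) // fg subrr normr0.
have gc : {within f @` U, continuous g}.
  apply/subspace_continuousP => h hU.
  apply/cvgrPdist_lt => e e0.
  have ce0 : 0 < c * e by rewrite mulr_gt0.
  have hb : nbhs h (ball h (c * e)) by exact: nbhsx_ballx.
  apply: filterS hb => k hk kU.
  have [Uh fh] := gU h hU; have [Uk fk] := gU k kU.
  rewrite -(ltr_pM2l c0) (le_lt_trans (fc _ _ Uh Uk)) // fh fk.
  by move: hk; rewrite -ball_normE.
have fcont x : U x -> {for x, continuous f} := fs 0%N x.
split.
  (* [g] is a homeomorphism from the image onto [U], so the countable basis is pulled back from the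
     row vectors. *)
  apply: (second_countable_initial (sigL (f @` U) g)).
  - exact/subspace_sigL_continuousP.
  - move=> z A [_ [[V oV <-] /= Vz VA]].
    have [Ug fg] := gU (set_val z) (set_mem (valP z)).
    exists (f @^-1` V).
      apply: fcont => //; rewrite fg; exact: open_nbhs_nbhs.
    move=> y /= Vy; apply: VA => /=.
    by have [_ <-] := gU (set_val y) (set_mem (valP y)).
  - exact: second_countable_rV.
pose ch := Chart U f g.
exists [set ch]; split.
  split=> [_ ->|x Mx|_ _ -> ->].
  - split => //.
      by exists setT; [exact: openT|rewrite setIT].
    apply/subspace_continuousP => x Ux.
    by apply: cvg_within_filter; exact: fcont.
  - by exists ch.
  - rewrite /smoothly_compatible.
    rewrite (_ : _ `&` chart_param ch @^-1` _ = U); last first.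
      by apply/seteqP; split=> [x []//|x Ux]; split=> //; exists x.
    by move=> k; apply: (C_on_eq _ _ id) (smooth_on_id U k) => // x /gK.
by move=> _ ->.
Qed.

(** * Quantitative bounds on the Jacobian and positivity of the radius *)

Lemma nondegenerate_le {R : realType} {H : normedModType R}
    (dot : {dot H for idfun}) {p : nat} (u : 'rV[R]_p -> H) (lambda : R) w v :
  induces_norm dot -> 0 <= lambda -> nondegenerate_jacobian dot u lambda w ->
  2 * lambda * enorm v <= `|'d u w v|.
Proof.
move=> dotE l0 [_ /(_ v)].
(* Evaluating the Loewner inequality at [v] compares squared norms; the factor 4 becomes 2 after
   taking roots. *)
have -> : edot (adjoint dot ('d u w) ('d u w v) - (4 * lambda ^+ 2) *: v) v =
    `|'d u w v| ^+ 2 - 4 * lambda ^+ 2 * edot v v.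
  rewrite dotE (adjointP dot ('d u w)) /edot mulr_sumr -sumrB.
  by apply: eq_bigr => i _; rewrite !mxE; ring.
rewrite subr_ge0 -sqr_enorm => h.
rewrite -(@ler_pXn2r _ 2) ?nnegrE ?mulr_ge0 ?enorm_ge0 //.
by apply: le_trans h; rewrite le_eqVlt; apply/orP; left; apply/eqP; ring.
Qed.

Lemma lipschitz_jacobian_le {R : realType} {p : nat} {H : normedModType R}
    (u : 'rV[R]_p -> H) (L : R) w1 w2 v :
  lipschitz_jacobian u L ->
  `|'d u w1 v - 'd u w2 v| <= L * enorm (w1 - w2) * enorm v.
Proof.
move=> [[du _] uL].
have cB : continuous ('d u w1 \- 'd u w2).
  by move=> x; apply: continuousB; exact: diff_continuous (du _ I) _.
apply: le_trans (le_opnorm ('d u w1 \- 'd u w2) v cB) _.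
by rewrite ler_wpM2r ?enorm_ge0 // uL.
Qed.

Lemma localization_radius_gt0 {R : realType} {p : nat} {H : normedModType R}
    (u : 'rV[R]_p -> H) wt (L lambda Lip tau mF LF : R) :
  0 < L -> 0 < lambda -> 0 < Lip -> 0 < tau -> 0 < mF -> 0 <= LF ->
  0 < localization_radius u wt L lambda Lip tau mF LF.
Proof.
move=> L0 l0 Lip0 tau0 mF0 LF0; rewrite /localization_radius.
set D := opnorm _ _; have l2 : 0 < lambda ^+ 2 by rewrite exprn_gt0.
(* The root exceeds the absolute value of [D], so the sum is positive whatever the sign of [D]. *)
have Dl : 0 < Num.sqrt (D ^+ 2 + lambda ^+ 2) + D.
  have : `|D| < Num.sqrt (D ^+ 2 + lambda ^+ 2).
    by rewrite -sqrtr_sqr ltr_sqrt ?ltrDl // ltr_wpDl ?sqr_ge0.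
  by rewrite ltr_norml => /andP[]; rewrite -subr_gt0 opprK addrC.
have tLF : 0 < 1 + tau * LF by rewrite ltr_wpDr // mulr_ge0 // ltW.
by rewrite !lt_min !divr_gt0 ?mulr_gt0 // addr_gt0 // mulr_gt0.
Qed.

Theorem proposition5 (R : realType) (H : completeNormedModType R)
    (dot : {dot H for idfun}) (p : nat) (u : 'rV[R]_p -> H) (F : H -> R)
    (wt : 'rV[R]_p) (Lip L lambda mF LF tau : R) :
  induces_norm dot ->
  (1 <= p)%N ->
  smooth_on setT u ->
  0 < Lip ->
  (forall w1 w2, `|u w1 - u w2| <= Lip * enorm (w1 - w2)) ->
  continuously_differentiable F ->
  0 < mF ->
  strongly_convex F mF ->
  LF.-lipschitz (gradient dot F) ->
  0 < tau ->
  0 < L ->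
  lipschitz_jacobian u L ->
  0 < lambda ->
  nondegenerate_jacobian dot u lambda wt ->
  let r := localization_radius u wt L lambda Lip tau mF LF in
  [/\ smooth_embedded_submanifold p (increment_manifold u wt r),
      compact (localization_image u wt r) &
      localization_image u wt r `<=` increment_manifold u wt r].
Proof.
move=> dotE p0 us Lip0 _ _ mF0 _ gL tau0 L0 uL l0 und r.
have cu w : {for w, continuous u} := us 0%N w I.
have du w : differentiable u w by have [+ _] := us 1%N; exact.
have Dl v := nondegenerate_le dot u lambda wt v dotE (ltW l0) und.
have LF0 : 0 <= LF.
  pose e : 'rV[R]_p := delta_mx 0 (Ordinal p0).
  have De : 0 < `|'d u wt e|.
    apply: lt_le_trans (Dl e); rewrite mulr_gt0 ?mulr_gt0 //.
    rewrite lt_def enorm_ge0 andbT.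
    apply/eqP => /enorm_eq0/rowP/(_ (Ordinal p0)).
    by rewrite !mxE !eqxx => /eqP; rewrite oner_eq0.
  (* Comparing gradients at the nonzero vector ['d u wt e] and at 0 forces [LF] to be
     nonnegative. *)
  have := gL ('d u wt e, 0) (conj I I); rewrite /= subr0 => h.
  by rewrite -(pmulr_lge0 _ De) (le_trans _ h).
have r0 : 0 < r by exact: localization_radius_gt0.
have rL : L * r <= lambda.
  by rewrite mulrC -ler_pdivlMr // /r /localization_radius ge_min lexx.
pose U := [set w | enorm (w - wt) < r].
have Uo : open U by exact: open_enorm_ball.
have dclose w v : U w -> `|'d u w v - 'd u wt v| <= lambda * enorm v.
  move=> Uw; apply: le_trans (lipschitz_jacobian_le u L w wt v uL) _.
  rewrite ler_wpM2r ?enorm_ge0 // (le_trans _ rL) // ler_pM2l //; exact: ltW.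
(* Of the lower bound [2 * lambda] at [wt], one [lambda] is spent on the deviation of the Jacobian
   and one remains. *)
have absorb (a b c : R) :
    2 * lambda * c <= a -> a - b <= lambda * c -> lambda * c <= b.
  by lra.
have ul x y : U x -> U y -> lambda * enorm (x - y) <= `|u x - u y|.
  move=> Ux Uy.
  (* The segment from [y] to [x] stays in the convex set [U], where [dclose] bounds the deviation
     from the linearization at [wt]. *)
  have := mean_value_le dot dotE u y (x - y) ('d u wt (x - y))
    (lambda * enorm (x - y)) du.
  rewrite subrKC => /(_ _)/wrap[t t01|].
    apply: dclose; rewrite /U /= addrAC.
    have -> : x - y = (x - wt) - (y - wt) by rewrite opprB addrA subrK.
    exact: enorm_lt_segment.
  rewrite distrC => /(le_trans (lerB_dist _ _)).
  exact: absorb (Dl (x - y)).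
have dU w v : U w -> lambda * enorm v <= `|'d u w v|.
  move=> /(dclose w v); rewrite distrC => /(le_trans (lerB_dist _ _)).
  exact: absorb (Dl v).
split.
- apply: (smooth_embedded_image U _ lambda) => //.
  + apply: smooth_on_subc => // k; exact: C_on_sub (us k).
  (* The translation by [u wt] cancels, and the sup norm is dominated by [enorm]. *)
  + move=> x y Ux Uy; rewrite opprB addrA subrK.
    by rewrite (le_trans _ (ul x y Ux Uy)) // ler_pM2l // ler_norm_enorm.
  + move=> x Ux v w.
    have [_ ->] := diff_subc u (u wt) x (du x) => /eqP.
    rewrite -subr_eq0 -linearB -normr_le0 => vw.
    apply/eqP; rewrite -subr_eq0; apply/eqP/enorm_eq0/eqP.
    rewrite eq_le enorm_ge0 andbT -(pmulr_rle0 _ l0).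
    exact: le_trans (dU x _ Ux) vw.
- apply: continuous_compact; last exact: compact_enorm_ball.
  apply: continuous_subspaceT => w.
  by apply: continuousB => //; exact: cst_continuous.
- move=> _ [w wr <-]; exists w => //=; apply: le_lt_trans wr _.
  by rewrite ltr_pdivrMr // ltr_pMr // ltr1n.
Qed.
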